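(* Let $F$ be a loopless digraph and let $n\ge 1$. Suppose that there is an $F$-free digraph $G_n$ on $n$ vertices with nonincreasing out-degree sequence $b_1^{(n)}\ge b_2^{(n)}\ge\cdots\ge b_n^{(n)}$ such that $$\sum_{i=1}^{j}b_i^{(n)}=\operatorname{ex}(j,F)+j(n-j)\qquad\text{for every }1\le j\le n.$$ Then, for every nondecreasing convex function $\varphi:[0,n-1]\to\mathbb R$, $$\operatorname{ex}_\varphi^+(n,F)=\sum_{i=1}^{n}\varphi\big(b_i^{(n)}\big).$$
   Context: Digraphs are finite and loopless; digons (pairs of opposite arcs on the same two vertices) are allowed, and opposite arcs are counted separately. A digraph is $F$-free if it contains no (not necessarily induced) subdigraph isomorphic to $F$. $A(D)$ is the arc set and $d_D^+(v)$ the out-degree. Define $$\operatorname{ex}(j,F)=\max\{|A(D)| : |V(D)|=j,\ D\text{ is }F\text{-free}\},$$ $$\operatorname{ex}_\varphi^+(n,F)=\max\Big\{\sum_{v\in V(D)}\varphi(d_D^+(v)) : |V(D)|=n,\ D\text{ is }F\text{-free}\Big\}.$$ *)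

(* Defs.v *)
From HB Require Import structures.
From mathcomp Require Import all_boot all_order all_algebra.

Set Implicit Arguments.
Unset Strict Implicit.
Unset Printing Implicit Defensive.

Import Order.TTheory GRing.Theory Num.Theory.

Definition loopless (V : finType) (A : {set V * V}) : bool :=
  [forall v, (v, v) \notin A].

(* Arcs are ordered pairs, so digons are allowed and opposite arcs are counted
   separately in [#|arcs D|]. *)
Record digraph (V : finType) := Digraph {
  arcs : {set V * V};
  _ : loopless arcs
}.

HB.instance Definition _ (V : finType) := [isSub for @arcs V].
HB.instance Definition _ (V : finType) := [Countable of digraph V by <:].
HB.instance Definition _ (V : finType) := [Finite of digraph V by <:].

Definition outdeg (V : finType) (D : digraph V) (v : V) : nat :=
  #|[set w | (v, w) \in arcs D]|.

Definition outdeg_seq (V : finType) (D : digraph V) : seq nat :=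
  sort geq [seq outdeg D v | v : V].

(* [(U, B)] is a (not necessarily induced) subdigraph of [D], with vertex set
   [U] and arc set [B]. *)
Definition subdigraph (V : finType) (D : digraph V)
    (U : {set V}) (B : {set V * V}) : bool :=
  (B \subset arcs D) && (B \subset setX U U).

(* [f] is an isomorphism from [F] onto the digraph with vertex set [U] and arc
   set [B]. *)
Definition isomorphism (W V : finType) (F : digraph W)
    (U : {set V}) (B : {set V * V}) (f : {ffun W -> V}) : bool :=
  [&& injectiveb f, f @: [set: W] == U &
      [forall x, forall y, ((x, y) \in arcs F) == ((f x, f y) \in B)]].

Definition contains (W V : finType) (F : digraph W) (D : digraph V) : bool :=
  [exists U : {set V}, exists B : {set V * V},
     subdigraph D U B && [exists f, isomorphism F U B f]].

Definition digraph_free (W V : finType) (F : digraph W)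
    (D : digraph V) : bool :=
  ~~ contains F D.

(* If some [F]-free digraph on [j] vertices exists this is the true maximum
   (see [ex_is_max]); otherwise it is 0. *)
Definition ex (W : finType) (j : nat) (F : digraph W) : nat :=
  \max_(D : digraph 'I_j | digraph_free F D) #|arcs D|.

Lemma loopless0 (V : finType) : loopless (set0 : {set V * V}).
Proof. by apply/forallP => v; rewrite inE. Qed.

Definition arcless (V : finType) : digraph V := Digraph (loopless0 V).

Section WeightedExtremal.
Local Open Scope ring_scope.

Definition outdeg_weight (R : realDomainType) (phi : R -> R) (V : finType)
    (D : digraph V) : R :=
  \sum_(v : V) phi (outdeg D v)%:R.

(* The default value of the iterated maximum is the weight of the arcless
   digraph, which is [F]-free as soon as some digraph on [n] vertices is; it
   is a true maximum in that case (see [ex_plus_is_max]). *)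
Definition ex_plus (R : realDomainType) (phi : R -> R) (W : finType) (n : nat)
    (F : digraph W) : R :=
  \big[Num.max/outdeg_weight phi (arcless 'I_n)]_(D : digraph 'I_n |
    digraph_free F D) outdeg_weight phi D.

End WeightedExtremal.

Lemma containsP (W V : finType) (F : digraph W) (D : digraph V) :
  reflect (exists2 f : {ffun W -> V}, injective f &
             forall x y, (x, y) \in arcs F -> (f x, f y) \in arcs D)
          (contains F D).
Proof.
apply: (iffP existsP) => [[U /existsP[B /andP[/andP[sBD _]]]]|[f injf hf]].
  case/existsP=> f /and3P[/injectiveP injf _ /forallP hf].
  exists f => // x y Fxy; apply: (subsetP sBD).
  by rewrite -(eqP (forallP (hf x) y)).
exists (f @: [set: W]); apply/existsP.
exists [set (f p.1, f p.2) | p in arcs F].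
rewrite /subdigraph -andbA; apply/and3P; split.
- by apply/subsetP=> _ /imsetP[[x y] /= Fxy ->]; apply: hf.
- by apply/subsetP=> _ /imsetP[[x y] /= Fxy ->]; rewrite inE /= !imset_f ?inE.
apply/existsP; exists f; apply/and3P; split=> //; first exact/injectiveP.
apply/forallP=> x; apply/forallP=> y; apply/eqP; apply/idP/idP=> [Fxy|].
  by apply/imsetP; exists (x, y).
by case/imsetP=> -[x' y'] /= Fxy [/injf-> /injf->].
Qed.

Lemma digraph_free_arcless (W V : finType) (F : digraph W) (D : digraph V) :
  digraph_free F D -> digraph_free F (arcless V).
Proof.
apply: contraNN => /containsP[f injf hf]; apply/containsP; exists f => // x y.
by move/hf; rewrite inE.
Qed.

Lemma ex_is_max (W : finType) (j : nat) (F : digraph W) (D0 : digraph 'I_j) :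
  digraph_free F D0 ->
  (exists2 D : digraph 'I_j, digraph_free F D & #|arcs D| = ex j F) /\
  (forall D : digraph 'I_j, digraph_free F D -> #|arcs D| <= ex j F).
Proof.
move=> fD0; split=> [|D fD]; last first.
  exact: (leq_bigmax_cond (F := fun D : digraph 'I_j => #|arcs D|)).
have [|D fD eD] := @eq_bigmax_cond _ (digraph_free F)
                     (fun D : digraph 'I_j => #|arcs D|).
  by apply/card_gt0P; exists D0.
by exists D.
Qed.

Lemma ex_plus_is_max (R : realDomainType) (phi : R -> R) (W : finType)
    (n : nat) (F : digraph W) (D0 : digraph 'I_n) :
  digraph_free F D0 ->
  (exists2 D : digraph 'I_n, digraph_free F D &
     outdeg_weight phi D = ex_plus phi n F) /\
  (forall D : digraph 'I_n, digraph_free F D ->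
     (outdeg_weight phi D <= ex_plus phi n F)%R).
Proof.
move=> fD0; split=> [|D fD]; last exact: le_bigmax_cond.
rewrite /ex_plus; elim/big_ind: _ => [|x y [D fD <-] [D' fD' <-]|D fD].
- by exists (arcless 'I_n) => //; apply: digraph_free_arcless fD0.
- by case: leP => _; [exists D' | exists D].
- by exists D.
Qed.

(* Main.v *)
(** The [j] largest out-degrees of an [F]-free digraph on [n] vertices sum to
    at most [ex j F + j (n - j)]: the arcs inside the [j] chosen vertices form
    an [F]-free digraph, and at most [j (n - j)] arcs leave them.  So the
    out-degree sequence of [G] weakly majorizes that of every [F]-free
    digraph, and the theorem is the Tomic-Weyl inequality: the slope of [phi]
    to the left of a degree is nonnegative and nondecreasing, and summation by
    parts against the partial sums of the differences concludes. *)
Require Import Defs.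
From mathcomp Require Import all_boot all_order all_algebra.
From mathcomp Require Import classical_sets set_interval reals numfun convex.
From mathcomp Require Import interval_inference lra.

Set Implicit Arguments.
Unset Strict Implicit.
Unset Printing Implicit Defensive.

Import Order.TTheory GRing.Theory Num.Theory.

Lemma sum_outdeg (V : finType) (D : digraph V) :
  \sum_(v : V) outdeg D v = #|arcs D|.
Proof.
under eq_bigr do rewrite /outdeg -sum1_card.
rewrite pair_big_dep /= -sum1_card; apply: eq_bigl => -[v w] /=.
by rewrite inE.
Qed.

Lemma outdeg_le_pred (V : finType) (D : digraph V) (v : V) :
  outdeg D v <= #|V|.-1.
Proof.
rewrite -(cardsC1 v); apply/subset_leq_card/fintype.subsetP => w; rewrite !inE.
by apply: contraTneq => ->; case: D => A /= /forallP.
Qed.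

Lemma preim_loopless (U V : finType) (g : U -> V) (D : digraph V) :
  loopless [set p | (g p.1, g p.2) \in arcs D].
Proof. by apply/forallP => u; rewrite inE; case: D => A /= /forallP. Qed.

(** For injective [g], a copy on [U] of the subdigraph induced on the image of [g]. Since [ex j F]
    ranges over digraphs on ['I_j], chosen vertices must be relabelled this way. *)
Definition preim_digraph (U V : finType) (g : U -> V) (D : digraph V) :=
  Digraph (preim_loopless g D).

Lemma preim_digraph_free (W U V : finType) (F : digraph W) (D : digraph V)
    (g : U -> V) :
  injective g -> digraph_free F D -> digraph_free F (preim_digraph g D).
Proof.
move=> injg; apply: contraNN => /containsP[f injf hf]; apply/containsP.
exists [ffun w => g (f w)] => [x y|x y /hf].
  by rewrite !ffunE => /injg/injf.
by rewrite !ffunE inE.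
Qed.

(** Out-neighbours of [g u] in the image of [g] come from out-neighbours of [u]; the others lie in
    the complement of the image. *)
Lemma outdeg_le_preim (U V : finType) (g : U -> V) (D : digraph V) (u : U) :
  injective g ->
  outdeg D (g u) <= outdeg (preim_digraph g D) u + (#|V| - #|U|).
Proof.
move=> injg; set N := [set w | (g u, w) \in arcs D].
rewrite /outdeg -/N -(cardsID (g @: [set: U]) N); apply: leq_add.
  rewrite -(card_imset _ injg); apply/subset_leq_card/fintype.subsetP => w.
  by rewrite !inE => /andP[guw /imsetP[x _ wE]]; rewrite wE imset_f ?inE -?wE.
have -> : #|V| - #|U| = #|~: (g @: [set: U])|.
  by rewrite cardsCs finset.setCK card_imset // cardsT.
by apply/subset_leq_card/fintype.subsetP => w; rewrite !inE => /andP[].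
Qed.

Lemma sum_outdeg_le_ex (W V : finType) (F : digraph W) (D : digraph V) (j : nat)
    (g : 'I_j -> V) :
  injective g -> digraph_free F D ->
  \sum_(i < j) outdeg D (g i) <= ex j F + j * (#|V| - j).
Proof.
move=> injg freeD; pose D' := preim_digraph g D.
apply: (@leq_trans (\sum_(i < j) (outdeg D' i + (#|V| - j)))).
  by apply: leq_sum => i _; have := outdeg_le_preim D i injg; rewrite card_ord.
rewrite big_split /= sum_outdeg sum_nat_const card_ord leq_add2r.
have freeD' := preim_digraph_free injg freeD.
by have [_ ->] := ex_is_max freeD'.
Qed.

Lemma size_outdeg_seq (V : finType) (D : digraph V) :
  size (outdeg_seq D) = #|V|.
Proof. by rewrite size_sort size_map -cardE. Qed.

Lemma nth_outdeg_seq_le_pred (V : finType) (D : digraph V) (i : nat) :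
  nth 0 (outdeg_seq D) i <= #|V|.-1.
Proof.
have [iV|/(nth_default _)-> //] := ltnP i (size (outdeg_seq D)).
have /(all_nthP 0)-> // : all (fun d => d <= #|V|.-1) (outdeg_seq D).
rewrite all_sort; apply/allP => _ /mapP[v _ ->]; exact: outdeg_le_pred.
Qed.

Lemma nth_outdeg_seq_nonincreasing (V : finType) (D : digraph V) (i : nat) :
  nth 0 (outdeg_seq D) i.+1 <= nth 0 (outdeg_seq D) i.
Proof.
have [iV|/(nth_default _)-> //] := ltnP i.+1 (size (outdeg_seq D)).
have /(sortedP 0)/(_ i iV) // : sorted geq (outdeg_seq D).
by apply: sort_sorted => x y; exact: leq_total.
Qed.

Lemma sum_outdeg_seq_le_ex (W V : finType) (F : digraph W) (D : digraph V)
    (j : nat) :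
  j <= #|V| -> digraph_free F D ->
  \sum_(i < j) nth 0 (outdeg_seq D) i <= ex j F + j * (#|V| - j).
Proof.
(* Sorting the vertices themselves by out-degree makes the first [j] of them realise the first [j]
   entries of [outdeg_seq D]. *)
move=> jV freeD; pose s := sort (relpre (outdeg D) geq) (enum V).
have sizes : size s = #|V| by rewrite size_sort -cardE.
have us : uniq s by rewrite sort_uniq enum_uniq.
(* A positive [j] provides the vertex [v0] that [nth] needs as default. *)
have [->|j_gt0] := posnP j; first by rewrite big_ord0.
have /card_gt0P[v0 _] : 0 < #|V| := leq_trans j_gt0 jV.
have lt_s (i : 'I_j) : i < size s by rewrite sizes (leq_trans (ltn_ord i)).
have injg : injective (fun i : 'I_j => nth v0 s i).
  by move=> i k /eqP; rewrite nth_uniq ?lt_s // => /eqP/val_inj.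
apply: leq_trans (sum_outdeg_le_ex injg freeD).
apply: leq_sum => i _; rewrite /outdeg_seq sort_map.
by rewrite (nth_map v0) // lt_s.
Qed.

Local Open Scope ring_scope.

Lemma outdeg_weight_seq (R : realDomainType) (phi : R -> R) (V : finType)
    (D : digraph V) :
  outdeg_weight phi D = \sum_(i < #|V|) phi (nth 0%N (outdeg_seq D) i)%:R.
Proof.
rewrite -(size_outdeg_seq D) -(big_mkord xpredT (fun i => phi (nth 0%N _ i)%:R)).
rewrite -(big_nth 0%N xpredT (fun d => phi d%:R)).
by rewrite (perm_big _ (permEl (perm_sort _ _))) big_map big_enum.
Qed.

Lemma sum_by_parts_ge0 (R : realDomainType) (n : nat) (c x : nat -> R) :
  (forall i, (i < n)%N -> 0 <= c i) ->
  (forall i, (i.+1 < n)%N -> c i.+1 <= c i) ->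
  (forall j, (j <= n)%N -> 0 <= \sum_(i < j) x i) ->
  0 <= \sum_(i < n) c i * x i.
Proof.
case: n => [|n] c_ge0 c_dec x_ge0; first by rewrite big_ord0.
(* Summation by parts as an induction: lowering the coefficient of a nonnegative partial sum from
   [c k] to [c k.+1] only decreases the left side. *)
suff H k : (k <= n)%N -> c k * \sum_(i < k.+1) x i <= \sum_(i < k.+1) c i * x i.
  by apply: le_trans (H n _); rewrite ?mulr_ge0 ?c_ge0 ?x_ge0.
elim: k => [|k IHk] kn; first by rewrite !big_ord1.
rewrite (big_ord_recr k.+1) [leRHS]big_ord_recr /= mulrDr lerD2r.
apply: le_trans (IHk (ltnW kn)).
by rewrite ler_wpM2r ?c_dec ?x_ge0 // ltnW.
Qed.

Section DiscreteConvex.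
Variables (R : realDomainType) (f : nat -> R) (N : nat).
Hypothesis f_ndecr : forall k, (k < N)%N -> f k <= f k.+1.
Hypothesis f_conv : forall k, (k.+1 < N)%N -> f k.+1 *+ 2 <= f k + f k.+2.

(* At [0] the truncated predecessor makes this [0]. *)
Definition left_slope (k : nat) : R := f k - f k.-1.

Lemma left_slope_ge0 k : (k <= N)%N -> 0 <= left_slope k.
Proof. by case: k => [|k] kN; rewrite subr_ge0 //= f_ndecr. Qed.

Lemma le_left_slope k l : (k <= l <= N)%N -> left_slope k <= left_slope l.
Proof.
case/andP=> /subnKC <-; elim: (l - k)%N => [|m IHm]; rewrite ?addn0 // addnS.
move=> mN.
apply: le_trans (IHm (ltnW mN)) _.
(* At [0] the slope is [0] by truncation, so monotonicity of [f] replaces convexity. *)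
case: (k + m)%N mN => [|p] pN.
  by rewrite {1}/left_slope subrr left_slope_ge0.
by have := f_conv pN; rewrite /left_slope /=; lra.
Qed.

(** The left slope is a subgradient: increments of [f] to the right of [d] are at least
    [left_slope d], those to the left at most that. *)
Lemma left_slope_tangent d b : (d <= N)%N -> (b <= N)%N ->
  left_slope d * (b%:R - d%:R) <= f b - f d.
Proof.
move=> dN bN; have [db|/ltnW bd] := leqP d b.
  move: db bN => /subnKC <-; elim: (b - d)%N => [|m IHm].
    by rewrite addn0 !subrr mulr0.
  rewrite addnS => mN; have := IHm (ltnW mN).
  have : left_slope d <= left_slope (d + m).+1.
    by rewrite le_left_slope // mN leqW ?leq_addr.
  by rewrite {2}/left_slope /= -natr1 !natrD; lra.
(* Here [b] stays fixed and the point of tangency moves right; the gain in slope is multiplied by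
   the distance [m]. *)
move: bd dN => /subnKC <-; elim: (d - b)%N => [|m IHm].
  by rewrite addn0 !subrr mulr0.
rewrite addnS => mN; have := IHm (ltnW mN).
have : left_slope (b + m) <= left_slope (b + m).+1.
  by rewrite le_left_slope // mN leqnSn.
move=> /(ler_wpM2r (ler0n R m)); rewrite {2 3}/left_slope /= -natr1 !natrD.
by rewrite /left_slope /=; lra.
Qed.

Lemma weak_majorization_le_sum (n : nat) (d b : nat -> nat) :
  (forall i, d i <= N)%N -> (forall i, b i <= N)%N ->
  (forall i, d i.+1 <= d i)%N ->
  (forall j, (j <= n)%N -> (\sum_(i < j) d i <= \sum_(i < j) b i)%N) ->
  \sum_(i < n) f (d i) <= \sum_(i < n) f (b i).
Proof.
move=> dN bN d_dec db; rewrite -subr_ge0 -sumrB.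
apply: (@le_trans _ _ (\sum_(i < n) left_slope (d i) * ((b i)%:R - (d i)%:R))).
  apply: (@sum_by_parts_ge0 _ n (fun i => left_slope (d i))
            (fun i => (b i)%:R - (d i)%:R)) => [i _|i _|j jn].
  - exact: left_slope_ge0.
  - by rewrite le_left_slope // d_dec dN.
  - by rewrite sumrB subr_ge0 -!natr_sum ler_nat db.
by apply: ler_sum => i _; exact: left_slope_tangent.
Qed.

End DiscreteConvex.

(** Convexity with weight 1/2; at [k] and [k + 2] it yields the second-difference condition
    [f_conv]. *)
Lemma convex_function_midpoint (R : realType) (A : set R) (phi : R -> R)
    (x y : R) :
  convex_function (E := R^o) A phi -> A x -> A y ->
  phi ((x + y) / 2) *+ 2 <= phi x + phi y.
Proof.
move=> phi_convex Ax Ay.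
have half_ge0 : 0 <= 2^-1 :> R by lra.
have half_le1 : 2^-1 <= 1 :> R by lra.
have := phi_convex (Itv01 half_ge0 half_le1) x y.
rewrite !inE => /(_ Ax Ay); rewrite convRE [X in phi X](_ : _ = (x + y) / 2).
  by rewrite /= /unstable.onem; lra.
by rewrite [LHS](convRE x y) /= /unstable.onem; lra.
Qed.

Theorem theorem2p2 (R : realType) (W : finType) (F : digraph W) (n : nat)
    (n_ge1 : (1 <= n)%N)
    (G : digraph 'I_n) (G_free : digraph_free F G)
    (G_sums : forall j : nat, (1 <= j <= n)%N ->
       (\sum_(i < j) nth 0 (outdeg_seq G) i = ex j F + j * (n - j))%N)
    (phi : R -> R)
    (phi_nondecreasing : {in `[0, n.-1%:R] &, nondecreasing_fun phi})
    (phi_convex : convex_function (E := R^o) `[0, n.-1%:R]%classic phi) :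
  ex_plus phi n F = \sum_(i < n) phi (nth 0%N (outdeg_seq G) i)%:R.
Proof.
have in_itv k : (k <= n.-1)%N -> (k%:R : R) \in `[0, n.-1%:R].
  by move=> kn; rewrite in_itv /= ler0n ler_nat.
have weightE (D : digraph 'I_n) :
    outdeg_weight phi D = \sum_(i < n) phi (nth 0%N (outdeg_seq D) i)%:R.
  by rewrite outdeg_weight_seq card_ord.
have deg_le (D : digraph 'I_n) i : (nth 0 (outdeg_seq D) i <= n.-1)%N.
  by have := nth_outdeg_seq_le_pred D i; rewrite card_ord.
have [[D freeD exE] ex_ge] := ex_plus_is_max phi G_free.
(* [G] is itself a competitor, which gives one inequality; the other compares a maximiser [D] with
   [G]. *)
apply/le_anti; rewrite -weightE ex_ge // andbT -exE !weightE.
apply: (@weak_majorization_le_sum R (fun k => phi k%:R) n.-1) => //.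
- by move=> k kn; apply: phi_nondecreasing; rewrite ?in_itv ?ler_nat // ltnW.
- move=> k kn; have -> : k.+1%:R = (k%:R + k.+2%:R) / 2 :> R.
    by rewrite -addn2 -addn1 !natrD; lra.
  by apply: (convex_function_midpoint phi_convex); apply: in_itv; rewrite // 2?ltnW.
- exact: nth_outdeg_seq_nonincreasing.
(* [G_sums] starts at [j = 1]; for [j = 0] both sums are empty. *)
move=> [|j] jn; first by rewrite !big_ord0.
rewrite G_sums //; have := @sum_outdeg_seq_le_ex _ _ F D j.+1.
by rewrite card_ord; apply.
Qed.
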